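(* Let $(M,g)$ be a $3$-dimensional Riemannian manifold equipped with a Newman--Penrose frame $(\partial,\overline{\partial},\xi)$. Then the vector field $\xi$ is parallel (i.e. $\nabla\xi=0$) if and only if $\xi$ generates a geodesic, shear-free, non-expanding, and twist-free congruence.
   Context: $\nabla$ is the Levi-Civita connection of $g$. Newman--Penrose frame: for an orthonormal frame $(e_1,e_2,\xi)$ of $(M,g)$, $\partial=\frac1{\sqrt2}(e_1-ie_2)$ and $\overline{\partial}=\frac1{\sqrt2}(e_1+ie_2)$; $g$ and $\nabla$ are extended complex-(bi)linearly. Spin coefficients: $\sigma_{\mathrm{np}}=-g(\partial,\nabla_\partial\xi)$ (complex shear), $\rho_{\mathrm{np}}=g(\partial,\nabla_{\overline{\partial}}\xi)$, $\kappa_{\mathrm{np}}=-g(\partial,\nabla_\xi\xi)$. Write $\rho_{\mathrm{np}}=\Theta_{\mathrm{np}}+i\omega_{\mathrm{np}}$ with $\Theta_{\mathrm{np}}$ (expansion) and $\omega_{\mathrm{np}}$ (twist) real. The congruence generated by $\xi$ (its family of integral curves) is geodesic if $\kappa_{\mathrm{np}}=0$ (equivalently $\nabla_\xi\xi=0$), shear-free if $\sigma_{\mathrm{np}}=0$, non-expanding if $\Theta_{\mathrm{np}}=0$, and twist-free if $\omega_{\mathrm{np}}=0$. *)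

(* Defs.v *)
From HB Require Import structures.
From mathcomp Require Import all_boot all_order all_algebra.
From mathcomp Require Import all_classical all_reals all_analysis.
From mathcomp Require Import complex.
From mathcomp Require Import ring.
Set Implicit Arguments.
Unset Strict Implicit.
Unset Printing Implicit Defensive.
Import Order.TTheory GRing.Theory Num.Theory numFieldNormedType.Exports.
Local Open Scope classical_set_scope.
Local Open Scope ring_scope.

Section CkOn.
Context {R : realType} {n : nat}.
Implicit Types (U : set 'rV[R]_n) (f g : 'rV[R]_n -> R).

(* Only meaningful for [U] open: the values of [f] off [U] then play no role. *)
Fixpoint Ck_on (k : nat) U f : Prop :=
  (forall x, U x -> {for x, continuous f}) /\
  if k is k'.+1 then
    forall i : 'I_n, (forall x, U x -> derivable f x (delta_mx 0 i)) /\
                     Ck_on k' U ('D_(delta_mx 0 i) f)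
  else True.

Definition smooth_on U f : Prop := forall k, Ck_on k U f.

Lemma Ck_on_cont k U f :
  Ck_on k U f -> forall x, U x -> {for x, continuous f}.
Proof. by case: k => [|k] []. Qed.

Lemma Ck_onS k U f : Ck_on k.+1 U f -> Ck_on k U f.
Proof.
elim: k f => [|k IH] f; first by case.
move=> [cf df]; split=> // i; have [di Di] := df i; split=> //.
exact: IH.
Qed.

Lemma eq_on_open_near U f g x : open U -> U x ->
  (forall y, U y -> f y = g y) -> \forall y \near x, f y = g y.
Proof. by move=> oU Ux fg; apply: filterS fg _; exact: open_nbhs_nbhs. Qed.

Lemma eq_Ck_on k U f g : open U -> (forall x, U x -> f x = g x) ->
  Ck_on k U f -> Ck_on k U g.
Proof.
move=> oU; elim: k f g => [|k IH] f g fg /= [cf df].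
all: have cg x : U x -> {for x, continuous g} by
  (move=> Ux; rewrite /prop_for /continuous_at -(fg x Ux);
   exact: cvg_trans (near_eq_cvg (eq_on_open_near oU Ux fg)) (cf x Ux)).
  by split.
split=> // i; have [di Di] := df i; split=> [x Ux|].
  by exact: near_eq_derivable (eq_on_open_near oU Ux fg) (di x Ux).
apply: (IH _ ('D_(delta_mx 0 i) g) _ Di) => x Ux; apply: near_eq_derive.
exact: (eq_on_open_near oU Ux fg).
Qed.

Lemma Ck_on_cst k U (a : R) : open U -> Ck_on k U (cst a).
Proof.
move=> oU; elim: k a => [|k IH] a; split=> //; try by move=> x _; exact: cst_continuous.
move=> i; split=> [x _|]; first exact: derivable_cst.
by apply: (eq_Ck_on oU _ (IH 0)) => x _; rewrite derive_cst.
Qed.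

Lemma Ck_onD k U f g : open U ->
  Ck_on k U f -> Ck_on k U g -> Ck_on k U (f + g).
Proof.
move=> oU; elim: k f g => [|k IH] f g [cf df] [cg dg]; split=> //;
  try by move=> x Ux; apply: continuousD; [exact: cf|exact: cg].
move=> i; have [di Di] := df i; have [ei Ei] := dg i; split=> [x Ux|].
  by apply: derivableD; [exact: di|exact: ei].
apply: (eq_Ck_on oU _ (IH _ _ Di Ei)) => x Ux.
by rewrite deriveD//; [exact: di|exact: ei].
Qed.

Lemma Ck_onM k U f g : open U ->
  Ck_on k U f -> Ck_on k U g -> Ck_on k U (f * g).
Proof.
move=> oU; elim: k f g => [|k IH] f g Cf Cg; have [cf df] := Cf;
  have [cg dg] := Cg; split=> //;
  try by move=> x Ux; apply: continuousM; [exact: cf|exact: cg].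
move=> i; have [di Di] := df i; have [ei Ei] := dg i; split=> [x Ux|].
  by apply: derivableM; [exact: di|exact: ei].
have := Ck_onD oU (IH _ _ (Ck_onS Cf) Ei) (IH _ _ (Ck_onS Cg) Di).
apply: eq_Ck_on oU _ => x Ux.
by rewrite deriveM//; [exact: di|exact: ei].
Qed.

End CkOn.

Record chart (R : realType) (n : nat) (T : topologicalType) := Chart {
  chart_dom : set T;
  chart_img : set 'rV[R]_n;
  chart_fwd : T -> 'rV[R]_n;
  chart_bwd : 'rV[R]_n -> T;
  chart_dom_open : open chart_dom;
  chart_img_open : open chart_img;
  chart_fwd_img : forall p, chart_dom p -> chart_img (chart_fwd p);
  chart_bwd_dom : forall x, chart_img x -> chart_dom (chart_bwd x);
  chart_fwdK : forall p, chart_dom p -> chart_bwd (chart_fwd p) = p;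
  chart_bwdK : forall x, chart_img x -> chart_fwd (chart_bwd x) = x;
  chart_fwd_cont : forall p, chart_dom p -> {for p, continuous chart_fwd};
  chart_bwd_cont : forall x, chart_img x -> {for x, continuous chart_bwd}
}.

Definition smooth_transition (R : realType) n (T : topologicalType)
    (c d : chart R n T) : Prop :=
  forall i : 'I_n,
    smooth_on (chart_img c `&` chart_bwd c @^-1` chart_dom d)
              (fun x => chart_fwd d (chart_bwd c x) 0 i).

(* A smooth manifold without boundary, not assumed connected; its smooth
   structure is the one generated by [atlas], which need not be maximal. *)
Record manifold (R : realType) (n : nat) := Manifold {
  carrier :> topologicalType;
  atlas : set (chart R n carrier);
  manifold_hausdorff : hausdorff_space carrier;
  manifold_second_countable : @second_countable carrier;
  atlas_cover : forall p : carrier, exists2 c, atlas c & chart_dom c p;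
  atlas_compat : forall c d, atlas c -> atlas d -> smooth_transition c d
}.

Section SmoothFunctions.
Context {R : realType} {n : nat} (M : manifold R n).

Definition smooth (f : M -> R) : Prop :=
  forall c, atlas c -> smooth_on (chart_img c) (f \o chart_bwd c).

Definition smooth_pred : {pred M -> R} := fun f => `[< smooth f >].

Lemma smooth_subring : subring_closed smooth_pred.
Proof.
have oI c : open (@chart_img R n M c) by exact: chart_img_open.
have smcst (a : R) : smooth (cst a) by move=> c _ k; exact: Ck_on_cst.
have smM f g : smooth f -> smooth g -> smooth (f * g).
  by move=> sf sg c ac k; apply: Ck_onM (sf c ac k) (sg c ac k).
split; first exact/asboolP/smcst.
- move=> f g /asboolP sf /asboolP sg; apply/asboolP.
  have sN := smM _ _ (smcst (- 1)) sg.
  rewrite -mulN1r => c ac k; exact: Ck_onD (sf c ac k) (sN c ac k).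
- by move=> f g /asboolP sf /asboolP sg; apply/asboolP; exact: smM.
Qed.

Lemma smooth_submod : submod_closed smooth_pred.
Proof.
have oI c : open (@chart_img R n M c) by exact: chart_img_open.
have smcst (a : R) : smooth (cst a) by move=> c _ k; exact: Ck_on_cst.
split; first exact/asboolP/(smcst 0).
move=> a f g /asboolP sf /asboolP sg; apply/asboolP => c ac k.
apply: Ck_onD (sg c ac k) => //.
exact: Ck_onM (smcst a c ac k) (sf c ac k).
Qed.

HB.instance Definition _ :=
  GRing.isSubringClosed.Build (M -> R) smooth_pred smooth_subring.
HB.instance Definition _ :=
  GRing.isSubmodClosed.Build R (M -> R^o) smooth_pred smooth_submod.

Record smooth_fun := SmoothFun {
  smooth_val :> M -> R;
  smooth_valP : smooth_val \in smooth_pred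
}.

HB.instance Definition _ := [isSub for smooth_val].
HB.instance Definition _ := [Choice of smooth_fun by <:].
HB.instance Definition _ := [SubChoice_isSubZmodule of smooth_fun by <:].
HB.instance Definition _ :=
  GRing.SubZmodule_isSubPzRing.Build (M -> R) smooth_pred smooth_fun
    smooth_subring.
HB.instance Definition _ :=
  GRing.SubPzRing_isSubComPzRing.Build (M -> R) smooth_pred smooth_fun.
HB.instance Definition _ :=
  GRing.SubZmodule_isSubLmodule.Build R (M -> R^o) smooth_pred smooth_fun
    smooth_submod.

End SmoothFunctions.

Notation "'C^oo' M" := (smooth_fun M) (at level 10, M at level 9).

Section Tangent.
Context {R : realType} {n : nat} (M : manifold R n).

Definition derivation_at (p : M) (v : C^oo M -> R) : Prop :=
  (forall (a : R) f g, v (a *: f + g) = a * v f + v g) /\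
  (forall f g, v (f * g) = v f * g p + f p * v g).

Definition tangent_pred (p : M) : {pred C^oo M -> R^o} :=
  fun v => `[< derivation_at p v >].

Lemma tangent_submod (p : M) : submod_closed (tangent_pred p).
Proof.
split.
  apply/asboolP; split=> [a f g|f g].
    by change (0 = a * 0 + 0 :> R); ring.
  by change (0 = 0 * g p + f p * 0 :> R); ring.
move=> a u v /asboolP[ul um] /asboolP[vl vm].
apply/asboolP; split=> [b f g|f g].
  change (a * u (b *: f + g) + v (b *: f + g) =
    b * (a * u f + v f) + (a * u g + v g)).
  by rewrite ul vl; ring.
change (a * u (f * g) + v (f * g) =
  (a * u f + v f) * g p + f p * (a * u g + v g)).
by rewrite um vm; ring.
Qed.

HB.instance Definition _ (p : M) :=
  GRing.isSubmodClosed.Build R (C^oo M -> R^o) (tangent_pred p)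
    (tangent_submod p).

Record tangent (p : M) := Tangent {
  tangent_val :> C^oo M -> R^o;
  tangent_valP : tangent_val \in tangent_pred p
}.

HB.instance Definition _ (p : M) := [isSub for @tangent_val p].
HB.instance Definition _ (p : M) := [Choice of tangent p by <:].
HB.instance Definition _ (p : M) :=
  [SubChoice_isSubZmodule of tangent p by <:].
HB.instance Definition _ (p : M) :=
  [SubZmodule_isSubLmodule of tangent p by <:].

(* A section [p |-> X_p] of the tangent bundle that maps smooth functions to
   smooth functions is the same thing as a derivation of the R-algebra C^oo M,
   via [X f p = X_p f]. *)
Definition derivation (X : C^oo M -> C^oo M) : Prop :=
  (forall (a : R) f g, X (a *: f + g) = a *: X f + X g) /\
  (forall f g, X (f * g) = X f * g + f * X g).

Definition vfield_pred : {pred C^oo M -> (C^oo M)^o} :=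
  fun X => `[< derivation X >].

Lemma smooth_scalerAr (a : R) (f g : C^oo M) : f * (a *: g) = a *: (f * g).
Proof.
by apply/val_inj/funext => p; change (f p * (a * g p) = a * (f p * g p)); ring.
Qed.

Lemma vfield_submod : submod_closed vfield_pred.
Proof.
split.
  apply/asboolP; split=> [a f g|f g].
    by change (0 = a *: 0 + 0 :> C^oo M); rewrite scaler0 addr0.
  by change (0 = 0 * g + f * 0 :> C^oo M); ring.
move=> h X Y /asboolP[Xl Xm] /asboolP[Yl Ym].
apply/asboolP; split=> [b f g|f g].
  change (h * X (b *: f + g) + Y (b *: f + g) =
    b *: (h * X f + Y f) + (h * X g + Y g)).
  by rewrite Xl Yl mulrDr smooth_scalerAr !scalerDr addrACA.
change (h * X (f * g) + Y (f * g) =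
  (h * X f + Y f) * g + f * (h * X g + Y g)).
by rewrite Xm Ym; ring.
Qed.

HB.instance Definition _ :=
  GRing.isSubmodClosed.Build (C^oo M) (C^oo M -> (C^oo M)^o) vfield_pred
    vfield_submod.

Record vfield := VField {
  vfield_val :> C^oo M -> (C^oo M)^o;
  vfield_valP : vfield_val \in vfield_pred
}.

HB.instance Definition _ := [isSub for vfield_val].
HB.instance Definition _ := [Choice of vfield by <:].
HB.instance Definition _ := [SubChoice_isSubZmodule of vfield by <:].
HB.instance Definition _ := [SubZmodule_isSubLmodule of vfield by <:].

Lemma at_point_proof (X : vfield) (p : M) :
  (fun f => X f p) \in tangent_pred p.
Proof.
case: X => X /= /asboolP[Xl Xm]; apply/asboolP.
by split=> [a f g|f g]; rewrite ?Xl ?Xm.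
Qed.

Definition at_point (X : vfield) (p : M) : tangent p :=
  Tangent (at_point_proof X p).

Lemma bracket_proof (X Y : vfield) :
  (fun f => X (Y f) - Y (X f)) \in vfield_pred.
Proof.
case: X Y => X /= /asboolP[Xl Xm] [Y /= /asboolP[Yl Ym]]; apply/asboolP.
split=> [a f g|f g]; rewrite ?Xl ?Yl ?Xm ?Ym ?Xl ?Yl.
  by rewrite opprD addrACA scalerBr.
have XD u v : X (u + v) = X u + X v by have := Xl 1 u v; rewrite !scale1r.
have YD u v : Y (u + v) = Y u + Y v by have := Yl 1 u v; rewrite !scale1r.
by rewrite XD YD !Xm !Ym; ring.
Qed.

Definition bracket (X Y : vfield) : vfield := VField (bracket_proof X Y).

End Tangent.

Record riemannian_metric (R : realType) (n : nat) (M : manifold R n) := Metric {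
  inner : forall p : M, tangent p -> tangent p -> R;
  innerC : forall p (u v : tangent p), inner u v = inner v u;
  innerPl : forall p (a : R) (u v w : tangent p),
    inner (a *: u + v) w = a * inner u w + inner v w;
  inner_gt0 : forall p (u : tangent p), u != 0 -> 0 < inner u u;
  (* By bump functions, testing on global fields gives the usual smoothness of
     the tensor field. *)
  inner_smooth : forall X Y : vfield M,
    smooth (M := M) (fun p => inner (at_point X p) (at_point Y p))
}.

Section Connections.
Context {R : realType} {n : nat} {M : manifold R n}.
Implicit Types (X Y Z : vfield M) (f : C^oo M).

Definition metric_fun (g : riemannian_metric M) X Y : C^oo M :=
  SmoothFun (asboolT (inner_smooth g X Y)).

Definition connection (nabla : vfield M -> vfield M -> vfield M) : Prop :=
  [/\ forall f X Y Z, nabla (f *: X + Y) Z = f *: nabla X Z + nabla Y Z,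
      forall X Y Z, nabla X (Y + Z) = nabla X Y + nabla X Z
    & forall X f Y, nabla X (f *: Y) = (X f : C^oo M) *: Y + f *: nabla X Y].

(* At most one [nabla] satisfies this, by the Koszul formula. *)
Definition levi_civita (g : riemannian_metric M)
    (nabla : vfield M -> vfield M -> vfield M) : Prop :=
  [/\ connection nabla,
      forall X Y, nabla X Y - nabla Y X = bracket X Y
    & forall X Y Z, X (metric_fun g Y Z) =
        metric_fun g (nabla X Y) Z + metric_fun g Y (nabla X Z)].

Definition parallel (nabla : vfield M -> vfield M -> vfield M) X : Prop :=
  forall Y, nabla Y X = 0.

(* [(X, Y)] stands for the complex vector field X + i Y; [cmetric] and [cnabla]
   are the complex-bilinear (not sesquilinear) extensions. *)
Definition cvfield (M : manifold R n) : Type := (vfield M * vfield M)%type.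

Definition complexify X : cvfield M := (X, 0).

Definition cmetric (g : riemannian_metric M) (Z W : cvfield M) (p : M) : R[i] :=
  Complex (metric_fun g Z.1 W.1 p - metric_fun g Z.2 W.2 p)
          (metric_fun g Z.1 W.2 p + metric_fun g Z.2 W.1 p).

Definition cnabla (nabla : vfield M -> vfield M -> vfield M)
    (Z W : cvfield M) : cvfield M :=
  (nabla Z.1 W.1 - nabla Z.2 W.2, nabla Z.1 W.2 + nabla Z.2 W.1).

End Connections.

Definition frame_at (R : realType) n (M : manifold R n) m
    (E : 'I_m -> vfield M) (p : M) : Prop :=
  forall v : tangent p,
    exists! a : 'rV[R]_m, v = \sum_(i < m) a 0 i *: at_point (E i) p.

Definition orthonormal_frame (R : realType) n (M : manifold R n)
    (g : riemannian_metric M) m (E : 'I_m -> vfield M) : Prop :=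
  forall p, frame_at E p /\
    forall i j, inner g (at_point (E i) p) (at_point (E j) p) = (i == j)%:R.

Record np_frame (R : realType) (M : manifold R 3)
    (g : riemannian_metric M) := NPFrame {
  np_e1 : vfield M;
  np_e2 : vfield M;
  np_xi : vfield M;
  np_orthonormal :
    orthonormal_frame g (tnth [tuple np_e1; np_e2; np_xi])
}.

Section SpinCoefficients.
Context {R : realType} {M : manifold R 3} {g : riemannian_metric M}.
Variables (nabla : vfield M -> vfield M -> vfield M) (F : np_frame g).

(* The constant function 1/sqrt 2: vector fields form a C^oo M-module. *)
Let s : C^oo M := (Num.sqrt (2 : R))^-1 *: (1 : C^oo M).

Definition np_del : cvfield M := (s *: np_e1 F, - (s *: np_e2 F)).
Definition np_delbar : cvfield M := (s *: np_e1 F, s *: np_e2 F).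

Let xi : cvfield M := complexify (np_xi F).

Definition np_sigma (p : M) : R[i] :=
  - cmetric g np_del (cnabla nabla np_del xi) p.
Definition np_rho (p : M) : R[i] :=
  cmetric g np_del (cnabla nabla np_delbar xi) p.
Definition np_kappa (p : M) : R[i] :=
  - cmetric g np_del (cnabla nabla xi xi) p.

Definition np_expansion (p : M) : R := complex.Re (np_rho p).
Definition np_twist (p : M) : R := complex.Im (np_rho p).

Definition geodesic : Prop := forall p, np_kappa p = 0.
Definition shear_free : Prop := forall p, np_sigma p = 0.
Definition non_expanding : Prop := forall p, np_expansion p = 0.
Definition twist_free : Prop := forall p, np_twist p = 0.

End SpinCoefficients.

(* Main.v *)
(** In the frame (e1, e2, xi) the tensor nabla xi has the nine components
    A_ij = g(e_i, nabla_{e_j} xi).  Metric compatibility applied to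
    g(xi, xi) = 1 kills A_3j.  The other six are encoded by the spin
    coefficients: kappa = - (A_13 - i A_23) / sqrt 2,
    sigma = - (A_11 - A_22 - i (A_12 + A_21)) / 2 and
    rho = (A_11 + A_22 + i (A_12 - A_21)) / 2.  *)
Require Import Defs.
From mathcomp Require Import all_boot all_order all_algebra.
From mathcomp Require Import all_classical all_reals all_analysis.
From mathcomp Require Import complex ring lra.
Set Implicit Arguments.
Unset Strict Implicit.
Unset Printing Implicit Defensive.
Import Order.TTheory GRing.Theory Num.Theory.
Local Open Scope ring_scope.

(** * Vector fields as families of tangent vectors *)

Section VectorFields.
Context {R : realType} {n : nat} {M : manifold R n}.
Implicit Types (X Y Z : vfield M) (f : C^oo M) (p : M).

Lemma at_pointP p f X Y :
  at_point (f *: X + Y) p = f p *: at_point X p + at_point Y p.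
Proof. exact/val_inj/funext. Qed.

Lemma at_point0 p : at_point (0 : vfield M) p = 0.
Proof. exact/val_inj/funext. Qed.

Lemma at_pointD p X Y : at_point (X + Y) p = at_point X p + at_point Y p.
Proof. exact/val_inj/funext. Qed.

Lemma at_pointZ p f X : at_point (f *: X) p = f p *: at_point X p.
Proof. exact/val_inj/funext. Qed.

Lemma at_point_sum p m (E : 'I_m -> vfield M) :
  at_point (\sum_i E i) p = \sum_i at_point (E i) p.
Proof.
exact: (big_morph (fun X => at_point X p) (at_pointD p) (at_point0 p)).
Qed.

(** Since [X f p] is [at_point X p] applied to [f], linear algebra in each tangent space yields
    identities between global fields. *)
Lemma vfield_ext X Y : (forall p, at_point X p = at_point Y p) -> X = Y.
Proof.
move=> XY; apply/val_inj/funext => f; apply/val_inj/funext => p.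
exact: (congr1 (fun v : tangent p => v f) (XY p)).
Qed.

End VectorFields.

(** * Bilinearity of the metric over [C^oo M] and expansion in an orthonormal frame *)

Section Metric.
Context {R : realType} {n : nat} {M : manifold R n} (g : riemannian_metric M).
Implicit Types (X Y Z : vfield M) (f : C^oo M) (p : M).

Lemma inner0l p (w : tangent p) : inner g 0 w = 0.
(* With coefficient [-1] and zero vectors, the right-hand side of linearity cancels. *)
Proof. by have := innerPl g (-1) 0 0 w; rewrite scaler0 addr0 mulN1r addNr. Qed.

Lemma innerDl p (u v w : tangent p) :
  inner g (u + v) w = inner g u w + inner g v w.
Proof. by have := innerPl g 1 u v w; rewrite scale1r mul1r. Qed.

Lemma innerZl p a (u w : tangent p) : inner g (a *: u) w = a * inner g u w.
Proof. by have := innerPl g a u 0 w; rewrite inner0l !addr0. Qed.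

Lemma inner_suml p m (u : 'I_m -> tangent p) (w : tangent p) :
  inner g (\sum_i u i) w = \sum_i inner g (u i) w.
Proof.
apply: (big_morph (fun v => inner g v w)) => [u1 u2|]; first exact: innerDl.
exact: inner0l.
Qed.

Lemma metric_funC X Y : metric_fun g X Y = metric_fun g Y X.
Proof. apply/val_inj/funext => p; exact: innerC. Qed.

Lemma metric_funPl f X Y Z :
  metric_fun g (f *: X + Y) Z = f * metric_fun g X Z + metric_fun g Y Z.
Proof.
apply/val_inj/funext => p; rewrite /= at_pointP; exact: innerPl.
Qed.

Lemma metric_fun0l X : metric_fun g 0 X = 0.
Proof. by apply/val_inj/funext => p; rewrite /= at_point0 inner0l. Qed.

Lemma metric_funZl f X Y : metric_fun g (f *: X) Y = f * metric_fun g X Y.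
Proof. by have := metric_funPl f X 0 Y; rewrite metric_fun0l !addr0. Qed.

Lemma metric_funNl X Y : metric_fun g (- X) Y = - metric_fun g X Y.
Proof. by rewrite -scaleN1r metric_funZl mulN1r. Qed.

Lemma metric_fun0r X : metric_fun g X 0 = 0.
Proof. by rewrite metric_funC metric_fun0l. Qed.

Lemma metric_funZr f X Y : metric_fun g X (f *: Y) = f * metric_fun g X Y.
Proof. by rewrite metric_funC metric_funZl metric_funC. Qed.

Lemma metric_funNr X Y : metric_fun g X (- Y) = - metric_fun g X Y.
Proof. by rewrite metric_funC metric_funNl metric_funC. Qed.

Variables (m : nat) (E : 'I_m -> vfield M) (onE : orthonormal_frame g E).

Lemma orthonormal_metric_fun i j : metric_fun g (E i) (E j) = (i == j)%:R.
Proof.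
apply/val_inj/funext => p; have [_ /(_ i j) /= ->] := onE p.
by case: (i == j).
Qed.

(** A frame supplies coefficients point by point; pairing with [E i] identifies them with the values
    of the smooth functions [metric_fun g X (E i)], so the expansion holds over [C^oo M]. *)
Lemma orthonormal_expansion X : X = \sum_i metric_fun g X (E i) *: E i.
Proof.
apply: vfield_ext => p; have [frE orE] := onE p.
have [a [Xa _]] := frE (at_point X p).
rewrite at_point_sum Xa; apply: eq_bigr => i _.
rewrite at_pointZ; congr (_ *: _); rewrite /= Xa inner_suml (bigD1 i)//=.
rewrite innerZl orE eqxx mulr1 big1 ?addr0// => j ji.
by rewrite innerZl orE (negbTE ji) mulr0.
Qed.

Lemma orthonormal_eq0 X : (forall i, metric_fun g (E i) X = 0) -> X = 0.
Proof.
move=> X0; rewrite (orthonormal_expansion X) big1// => i _.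
by rewrite metric_funC X0 scale0r.
Qed.

End Metric.

(** * Connections evaluated along a frame *)

Section Connection.
Context {R : realType} {n : nat} {M : manifold R n}.
Context {nabla : vfield M -> vfield M -> vfield M} (cP : connection nabla).
Implicit Types (X Y Z : vfield M) (f : C^oo M).

Lemma connection0l X : nabla 0 X = 0.
Proof.
have [P _ _] := cP.
by have := P (-1) 0 0 X; rewrite scaler0 addr0 scaleN1r addNr.
Qed.

Lemma connectionZl f X Y : nabla (f *: X) Y = f *: nabla X Y.
Proof.
by have [P _ _] := cP; rewrite -[f *: X]addr0 P connection0l addr0.
Qed.

Lemma connectionDl X Y Z : nabla (X + Y) Z = nabla X Z + nabla Y Z.
Proof. by have [P _ _] := cP; have := P 1 X Y Z; rewrite !scale1r. Qed.

Lemma connectionNl X Y : nabla (- X) Y = - nabla X Y.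
Proof. by rewrite -scaleN1r connectionZl scaleN1r. Qed.

Lemma connection0r X : nabla X 0 = 0.
Proof.
have [_ D _] := cP; apply: (addrI (nabla X 0)).
by rewrite -D !addr0.
Qed.

Lemma cnabla_complexify (Z : cvfield M) X :
  cnabla nabla Z (complexify X) = (nabla Z.1 X, nabla Z.2 X).
Proof. by rewrite /cnabla /= !connection0r subr0 add0r. Qed.

(** [nabla] is [C^oo M]-linear in its direction, so expanding [Y] in the frame reduces to the
    directions [E i]. *)
Lemma parallel_frame (g : riemannian_metric M) m (E : 'I_m -> vfield M) X :
  orthonormal_frame g E -> (forall i, nabla (E i) X = 0) -> parallel nabla X.
Proof.
move=> onE E0 Y; rewrite (orthonormal_expansion onE Y).
rewrite (big_morph (nabla^~ X) (fun U V => connectionDl U V X)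
  (connection0l X)) big1// => i _.
by rewrite connectionZl E0 scaler0.
Qed.

End Connection.

(** As g(X, X) is constant, metric compatibility gives 0 = Y(g(X, X)) = 2 g(X, nabla_Y X). *)
Lemma metric_fun_nabla_unit (R : realType) n (M : manifold R n)
    (g : riemannian_metric M) nabla X Y :
  levi_civita g nabla -> metric_fun g X X = 1 ->
  metric_fun g X (nabla Y X) = 0.
Proof.
move=> [_ _ compat] X1; apply/val_inj/funext => p.
(* The Leibniz rule on [1 * 1] gives Y 1 = Y 1 + Y 1. *)
have Y1 : (Y : _ -> _) (1 : C^oo M) = 0.
  have /asboolP[_ YM] := vfield_valP Y.
  by apply: (addrI (Y 1)); have := YM 1 1; rewrite !mulr1 mul1r addr0.
have := compat Y X X; rewrite X1 Y1 (metric_funC g (nabla Y X)).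
move=> /(congr1 (fun f : C^oo M => f p)) /= /esym.
change (metric_fun g X (nabla Y X) p + metric_fun g X (nabla Y X) p = 0 ->
  metric_fun g X (nabla Y X) p = 0).
by lra.
Qed.

(** * Spin coefficients in terms of the components of nabla xi *)

Section SpinCoefficients.
Context {R : realType} {M : manifold R 3} {g : riemannian_metric M}.
Context {nabla : vfield M -> vfield M -> vfield M} (cP : connection nabla).
Variables (F : np_frame g) (p : M).

Local Notation e1 := (np_e1 F).
Local Notation e2 := (np_e2 F).
Local Notation xi := (np_xi F).
Local Notation A X Y := (metric_fun g X (nabla Y xi) p).

Lemma cmetricE (X1 X2 Y1 Y2 : vfield M) :
  cmetric g (X1, X2) (Y1, Y2) p =
  Complex (metric_fun g X1 Y1 p - metric_fun g X2 Y2 p)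
          (metric_fun g X1 Y2 p + metric_fun g X2 Y1 p).
Proof. by []. Qed.

Lemma np_kappaE :
  np_kappa nabla F p =
  (- Complex ((Num.sqrt 2)^-1 * A e1 xi) (- ((Num.sqrt 2)^-1 * A e2 xi)))%C.
Proof.
rewrite /np_kappa (cnabla_complexify cP) cmetricE (connection0l cP).
rewrite !metric_fun0r metric_funZl metric_funNl metric_funZl.
congr (- Complex _ _).
  (* The constant function 1/sqrt 2 is a scalar multiple of the unit function, so its value at [p]
     unfolds to [(Num.sqrt 2)^-1 * 1]. *)
  change ((Num.sqrt 2)^-1 * 1 * A e1 xi - 0 = (Num.sqrt 2)^-1 * A e1 xi); ring.
change (0 + - ((Num.sqrt 2)^-1 * 1 * A e2 xi) = - ((Num.sqrt 2)^-1 * A e2 xi)).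
ring.
Qed.

(** Source of the factor 1/2 in sigma and rho: each of the two complex frame vectors contributes
    1/sqrt 2. *)
Lemma sqrt2V_sqr : (Num.sqrt 2)^-1 * (Num.sqrt 2)^-1 = 2^-1 :> R.
Proof. by rewrite -invfM -expr2 sqr_sqrtr. Qed.

Lemma np_sigmaE :
  np_sigma nabla F p =
  - Complex ((A e1 e1 - A e2 e2) / 2) (- ((A e1 e2 + A e2 e1) / 2)).
Proof.
rewrite /np_sigma (cnabla_complexify cP) cmetricE.
rewrite (connectionNl cP) !(connectionZl cP).
rewrite !(metric_funNl, metric_funNr, metric_funZl, metric_funZr).
set s := (Num.sqrt 2)^-1; congr (- Complex _ _).
  change (s * 1 * (s * 1 * A e1 e1) - - - (s * 1 * (s * 1 * A e2 e2)) =
    (A e1 e1 - A e2 e2) / 2); rewrite -sqrt2V_sqr -/s; ring.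
change (- (s * 1 * (s * 1 * A e1 e2)) + - (s * 1 * (s * 1 * A e2 e1)) =
  - ((A e1 e2 + A e2 e1) / 2)); rewrite -sqrt2V_sqr -/s; ring.
Qed.

(** Differentiating along [np_delbar] instead of [np_del] reverses the sign of every e2-derivative,
    so the trace and the antisymmetric part replace the trace-free symmetric part seen by sigma. *)
Lemma np_rhoE :
  np_rho nabla F p =
  Complex ((A e1 e1 + A e2 e2) / 2) ((A e1 e2 - A e2 e1) / 2).
Proof.
rewrite /np_rho (cnabla_complexify cP) cmetricE !(connectionZl cP).
rewrite !(metric_funNl, metric_funZl, metric_funZr).
set s := (Num.sqrt 2)^-1; congr Complex.
  change (s * 1 * (s * 1 * A e1 e1) - - (s * 1 * (s * 1 * A e2 e2)) =
    (A e1 e1 + A e2 e2) / 2); rewrite -sqrt2V_sqr -/s; ring.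
change (s * 1 * (s * 1 * A e1 e2) + - (s * 1 * (s * 1 * A e2 e1)) =
  (A e1 e2 - A e2 e1) / 2); rewrite -sqrt2V_sqr -/s; ring.
Qed.

End SpinCoefficients.

Theorem theorem5p8 (R : realType) (M : manifold R 3) (g : riemannian_metric M)
    (nabla : vfield M -> vfield M -> vfield M) (nablaP : levi_civita g nabla)
    (F : np_frame g) :
  parallel nabla (np_xi F) <->
  [/\ geodesic nabla F, shear_free nabla F, non_expanding nabla F
    & twist_free nabla F].
Proof.
have [cP _ _] := nablaP.
split=> [par|[geo shear expand twist]].
  (* Each spin coefficient is, up to sign, such a pairing with a derivative of xi. *)
  have cpar Z W p : cmetric g Z (cnabla nabla W (complexify (np_xi F))) p = 0.
    rewrite (cnabla_complexify cP) !par /cmetric !metric_fun0r.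
    by congr Complex; [exact: subr0|exact: addr0].
  have kappa0 p : np_kappa nabla F p = 0 by rewrite /np_kappa cpar oppr0.
  have sigma0 p : np_sigma nabla F p = 0 by rewrite /np_sigma cpar oppr0.
  have rho0 p : np_rho nabla F p = 0 by exact: cpar.
  have expansion0 p : np_expansion nabla F p = 0 by rewrite /np_expansion rho0.
  have twist0 p : np_twist nabla F p = 0 by rewrite /np_twist rho0.
  by split.
have onE := np_orthonormal F; set E := tnth _ in onE.
have xi1 : metric_fun g (np_xi F) (np_xi F) = 1.
  (* [ord_max] is the index of [np_xi F], the last entry of the triple. *)
  exact: (orthonormal_metric_fun onE ord_max ord_max).
apply: (parallel_frame cP onE) => j; apply: (orthonormal_eq0 onE) => i.
apply/val_inj/funext => p.
move: (geo p) (shear p) (expand p) (twist p).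
rewrite /np_expansion /np_twist (np_kappaE cP) (np_sigmaE cP) (np_rhoE cP).
set A := fun X Y => metric_fun g X (nabla Y (np_xi F)) p.
rewrite -![metric_fun g _ _ p]/(A _ _).
(* Injectivity of [Complex] splits a complex equation into its real and imaginary parts. *)
move=> /eqP; rewrite oppr_eq0 => /eqP[k1 k2].
move=> /eqP; rewrite oppr_eq0 => /eqP[s1 s2].
move=> /= r1 r2.
have A3 Y : A (np_xi F) Y = 0 by rewrite /A (metric_fun_nabla_unit _ nablaP).
have s0 : (Num.sqrt 2)^-1 != 0 :> R by rewrite invr_eq0 gt_eqF// sqrtr_gt0.
have A13 : A (np_e1 F) (np_xi F) = 0 by apply: (mulfI s0); rewrite mulr0.
have A23 : A (np_e2 F) (np_xi F) = 0.
  (* The sign in [k2] comes from the imaginary part -e2/sqrt 2 of [np_del]. *)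
  by apply: (mulfI s0); rewrite mulr0; apply: oppr_inj; rewrite oppr0.
(* [s1] makes the two entries equal, [r1] makes them opposite. *)
have [A11 A22] : A (np_e1 F) (np_e1 F) = 0 /\ A (np_e2 F) (np_e2 F) = 0.
  by split; lra.
(* [s2] kills the sum of the two entries, [r2] their difference. *)
have [A12 A21] : A (np_e1 F) (np_e2 F) = 0 /\ A (np_e2 F) (np_e1 F) = 0.
  by split; lra.
change (A (E i) (E j) = 0).
by case: i => [[|[|[|//]]] i3]; case: j => [[|[|[|//]]] j3];
  rewrite /E /tnth /=.
Qed.
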